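(* Let $r\ge0$, $m\ge1$ be integers, let $a_1,\dots,a_r,b_1,\dots,b_r,t\in\mathbb{C}$, and for $i=1,\dots,m$ let $c_i,d_i,x_i\in\mathbb{C}$, where the $b_i$ and $c_i$ are not of the form $q^{-n}$, $d_i\neq q^n$ for positive integers $n$, and $|x_i|<1$. Then \[ \sum_{n=0}^\infty \frac{(a_1,\dots,a_{r};q)_{n}\,t^n}{(b_1,\dots,b_{r};q)_{n}} \prod_{i=1}^m\frac{(c_iq/x_i;q)_{n} x_i^n}{(x_id_iq;q)_{n}} =\sum_{n_1,\dots,n_m\geq 0}\prod_{i=1}^m\Omega(n_i;x_i,c_i,d_i)\; \sum_{k\ge0}\frac{(a_1,\dots,a_r;q)_k}{(b_1,\dots,b_r;q)_k}\prod_{i=1}^m\frac{(c_id_iq,\,q^{-n_i},\,c_iq^{n_i+2};q)_k}{(q,\,c_id_iq^{n_i+2},\,d_iq^{-n_i};q)_k}\,t^k, \] where \[ \Omega(n;x,c,d)=(1-xd)(1-cq^{2n+2})\,(xd)^{n}\frac{(q/d,cq/x;q)_{n} }{(cdq,xq;q)_{n+1}}. \]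
   Context: Fix $q\in\mathbb{C}$ with $|q|<1$. $(a;q)_\infty=\prod_{k\ge0}(1-aq^k)$, $(a;q)_n=(a;q)_\infty/(aq^n;q)_\infty$, $(a_1,\dots,a_m;q)_n=\prod_j(a_j;q)_n$. (In the paper the inner sum is written as the composition $\prod_i\Delta_{(n_i;c_i,d_i)}$ applied to ${}_r\widetilde\phi_r[a_1,\dots,a_r;b_1,\dots,b_r;q,t]=\sum_k\frac{(a_1,\dots,a_r;q)_k}{(b_1,\dots,b_r;q)_k}t^k$, where each operator $\Delta_{(n;c,d)}$ adjoins the numerator parameters $cdq,q^{-n},cq^{n+2}$ and denominator parameters $cdq^{n+2},q^{-n}d$ together with the factor $1/(q;q)_k$; the displayed inner sum is that composition written out.)
   Formalization: Added: q≠0; c_i d_i≠q^{-n} for n≥1; the left series converges; for each i, |x_i d_i|<1 or x_i=c_i q^N with N≥1. Otherwise terms are undefined, series diverge, or the identity fails (q=1/2, m=1, r=0, t=0, c=0, d=3, x=1/3 gives 1=0). *)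

(* Defs.v *)
From mathcomp Require Import all_boot all_order all_algebra finmap.
From mathcomp Require Import all_classical all_reals all_analysis.
From mathcomp Require Export summability.
From mathcomp Require Import complex.
Import Order.TTheory GRing.Theory Num.Theory.
Import numFieldNormedType.Exports.

Set Implicit Arguments.
Unset Strict Implicit.
Unset Printing Implicit Defensive.

Local Open Scope ring_scope.

Section QSeries.
Variable K : fieldType.
Implicit Types (q a x c d t : K) (k n : nat).

(* (a;q)_n as a finite product: the quotient (a;q)_oo / (aq^n;q)_oo would be
   0/0 at a = q^{-N}, a value that occurs below. *)
Definition qpoch q a n : K := \prod_(j < n) (1 - a * q ^+ j).

(* (a_1,...,a_r;q)_n *)
Definition qpochs q (r : nat) (a : 'I_r -> K) n : K :=
  \prod_(i < r) qpoch q (a i) n.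

(* x^n (a/x;q)_n, extended to x = 0 as a polynomial in x (see qpoch_divE). *)
Definition qpoch_div q a x n : K := \prod_(j < n) (x - a * q ^+ j).

Lemma qpoch_divE q a x n :
  x != 0 -> qpoch_div q a x n = qpoch q (a / x) n * x ^+ n.
Proof.
move=> x0; rewrite /qpoch_div /qpoch -[in x ^+ n](card_ord n) -prodr_const.
rewrite -big_split /=; apply: eq_bigr => j _.
by rewrite mulrBl mul1r mulrAC divfK.
Qed.

(* (xd)^n (q/d, cq/x; q)_n is written so as to make sense for x = 0 or d = 0;
   OmegaE gives the usual form. *)
Definition Omega q n x c d : K :=
  (1 - x * d) * (1 - c * q ^+ (2 * n + 2))
  * (qpoch_div q q d n * qpoch_div q (c * q) x n)
  / (qpoch q (c * d * q) n.+1 * qpoch q (x * q) n.+1).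

Lemma OmegaE q n x c d : x != 0 -> d != 0 ->
  Omega q n x c d =
  (1 - x * d) * (1 - c * q ^+ (2 * n + 2)) * (x * d) ^+ n
  * (qpoch q (q / d) n * qpoch q (c * q / x) n)
  / (qpoch q (c * d * q) n.+1 * qpoch q (x * q) n.+1).
Proof.
move=> x0 d0; rewrite /Omega !qpoch_divE//; congr (_ / _).
by rewrite -[RHS]mulrA; congr (_ * _); rewrite exprMn mulrACA mulrC [d ^+ n * _]mulrC.
Qed.

(* (a_1,...,a_r;q)_k t^k / (b_1,...,b_r;q)_k *)
Definition phi_term q (r : nat) (a b : 'I_r -> K) t k : K :=
  qpochs q a k / qpochs q b k * t ^+ k.

Definition lhs_term q (r m : nat) (a b : 'I_r -> K) t (c d x : 'I_m -> K) n : K :=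
  phi_term q a b t n *
  \prod_(i < m) (qpoch_div q (c i * q) (x i) n / qpoch q (x i * d i * q) n).

(* For n < k the numerator factor (q^{-n};q)_k is 0. *)
Definition Delta_factor q n c d k : K :=
  (qpoch q (c * d * q) k * qpoch q (q ^- n) k * qpoch q (c * q ^+ (n + 2)) k)
  / (qpoch q q k * qpoch q (c * d * q ^+ (n + 2)) k * qpoch q (d * q ^- n) k).

Definition inner_term q (r m : nat) (a b : 'I_r -> K) t (c d : 'I_m -> K)
    (n : {ffun 'I_m -> nat}) k : K :=
  phi_term q a b t k * \prod_(i < m) Delta_factor q (n i) (c i) (d i) k.

End QSeries.

Local Open Scope classical_set_scope.

(* R[i] carries its norm topology through the alias R[i]^o. *)
Definition converges (R : realType) (u : nat -> R[i]) : Prop :=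
  cvgn (series u : nat -> R[i]^o).

Definition series_sum (R : realType) (u : nat -> R[i]) : R[i] :=
  limn (series u : nat -> R[i]^o).

(* Convergence of the net of finite partial sums; for complex terms this is
   absolute convergence of the family, with sum S. *)
Definition has_sum (R : realType) (I : choiceType) (u : I -> R[i]) (S : R[i]) : Prop :=
  (partial_sum u : {fset I} -> R[i]^o) @ totally --> (S : R[i]^o).

(* Main.v *)
(* For a single index, collecting the terms of the multiple series with a fixed k
   gives a very-well-poised 6phi5 series in n >= k, one of whose parameters is
   q^(k+1); its sum is (cq/x;q)_k x^k / (xdq;q)_k.  For k = 0 the partial sums
   telescope, and a Wilf-Zeilberger certificate yields the recurrence in k.

   The theorem is then an interchange of summations.  Since (a;q)_n is bounded,
   and bounded away from 0 if it never vanishes, convergence of the left-hand side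
   forces its terms to decay geometrically.  Hence the (k, n)-th term on the right
   is O(u^(k + n_1 + ... + n_m)) for some u < 1.  On a box n_i < L the multiple sum
   factors for each k, and the terms outside the box contribute O(u^L). *)

Require Import Defs.
From mathcomp Require Import all_boot all_order all_algebra finmap.
From mathcomp Require Import all_classical all_reals all_analysis.
From mathcomp Require Import complex.
From mathcomp Require Import ring lra zify.
Import Order.TTheory GRing.Theory Num.Theory.
Import numFieldNormedType.Exports.

Set Implicit Arguments.
Unset Strict Implicit.
Unset Printing Implicit Defensive.

Local Open Scope ring_scope.

(** * The summation formula for one index *)

Section QAlgebra.
Variable K : fieldType.
Implicit Types (q a x c d : K) (j k n : nat).

Lemma qpoch0 q a : qpoch q a 0 = 1.
Proof. by rewrite /qpoch big_ord0. Qed.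

Lemma qpochS q a n : qpoch q a n.+1 = qpoch q a n * (1 - a * q ^+ n).
Proof. by rewrite /qpoch big_ord_recr. Qed.

Lemma qpochSl q a n : qpoch q a n.+1 = (1 - a) * qpoch q (a * q) n.
Proof.
rewrite /qpoch big_ord_recl expr0 mulr1; congr (_ * _).
by apply: eq_bigr => i _; rewrite lift0 exprS mulrA.
Qed.

Lemma qpochD q a n k :
  qpoch q a (n + k) = qpoch q a n * qpoch q (a * q ^+ n) k.
Proof.
elim: k => [|k IHk]; first by rewrite addn0 qpoch0 mulr1.
by rewrite addnS !qpochS IHk -!mulrA exprD.
Qed.

Lemma qpoch_neq0 q a n :
  (forall j, 1 - a * q ^+ j != 0) -> qpoch q a n != 0.
Proof. by move=> a0; apply/prodf_neq0 => j _. Qed.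

Lemma qpoch_eq0 q a n k : (k < n)%N -> a * q ^+ k = 1 -> qpoch q a n = 0.
Proof.
move=> kn ak; apply/eqP/prodf_eq0; exists (Ordinal kn) => //=.
by rewrite ak subrr.
Qed.

Lemma qpoch_div0 q a x : qpoch_div q a x 0 = 1.
Proof. by rewrite /qpoch_div big_ord0. Qed.

Lemma qpoch_divS q a x n :
  qpoch_div q a x n.+1 = qpoch_div q a x n * (x - a * q ^+ n).
Proof. by rewrite /qpoch_div big_ord_recr. Qed.

Lemma qpoch_divD q a x n k :
  qpoch_div q a x (n + k) = qpoch_div q a x n * qpoch_div q (a * q ^+ n) x k.
Proof.
elim: k => [|k IHk]; first by rewrite addn0 qpoch_div0 mulr1.
by rewrite addnS !qpoch_divS IHk -!mulrA exprD.
Qed.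

Lemma qpoch_div_eq0 q a x n k :
  (k < n)%N -> x = a * q ^+ k -> qpoch_div q a x n = 0.
Proof.
move=> kn xk; apply/eqP/prodf_eq0; exists (Ordinal kn) => //=.
by rewrite xk subrr.
Qed.

(* The quotient (q^{-n};q)_k / (d q^{-n};q)_k for n = k + j, multiplied by
   d^n (q/d;q)_n, so that d = 0 is allowed. *)
Lemma qpoch_reflect q d j k : q != 0 ->
  qpoch q (q ^- (k + j)) k * qpoch_div q q d (k + j) * qpoch q q j =
  qpoch q (d * q ^- (k + j)) k * qpoch_div q q d j * qpoch q q (k + j).
Proof.
move=> q0; elim: k => [|k IHk]; first by rewrite !qpoch0 !mul1r.
have qV : q ^- (k.+1 + j) * q = q ^- (k + j).
  by rewrite addSn exprS invfM mulrAC mulVf // mul1r.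
rewrite [qpoch q (q ^- _) _]qpochSl [qpoch q (d * _) _]qpochSl.
rewrite -(mulrA d) !qV addSn qpoch_divS [qpoch q q _.+1]qpochS -exprS.
have y0 : q ^+ (k + j).+1 != 0 by rewrite expf_neq0.
set y := q ^+ (k + j).+1 in y0 *.
transitivity ((1 - y^-1) * (d - y) *
  (qpoch q (q ^- (k + j)) k * qpoch_div q q d (k + j) * qpoch q q j)).
  by ring.
have -> : (1 - y^-1) * (d - y) = (1 - d * y^-1) * (1 - y) by field.
by rewrite IHk; ring.
Qed.

(* Omega(k + j; x, c, d) times the k-th Delta factor, with the powers of d that
   occur in both cancelled: this makes sense for d = 0. *)
Definition kernel q x c d k j : K :=
  (1 - x * d) * (1 - c * q ^+ (2 * (k + j) + 2))
  * (qpoch_div q q d j * qpoch_div q (c * q) x (k + j))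
  * (qpoch q q (k + j) * qpoch q (c * d * q) k * qpoch q (c * q ^+ (k + j + 2)) k)
  / (qpoch q q j * qpoch q q k
     * (qpoch q (c * d * q) (k + j + k).+1 * qpoch q (x * q) (k + j).+1)).

(** * Partial sums of the kernel: closed form for [k = 0], recurrence in [k] *)

Section KernelSums.
Variables q x c d : K.
Hypothesis q0 : q != 0.
Hypothesis q1 : forall n, 1 - q * q ^+ n != 0.
Hypothesis d1 : forall n, d != q ^+ n.+1.
Hypothesis cd1 : forall n, 1 - c * d * q * q ^+ n != 0.
Hypothesis xq1 : forall n, 1 - x * q * q ^+ n != 0.

(** With [n = k + j], [qpoch_reflect] trades the factors in negative powers of [q] for harmless
    ones, and [(cdq;q)_{n+1}] joins [(cdq^{n+2};q)_k] to form [(cdq;q)_{n+k+1}]. *)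
Lemma Omega_Delta_factor k j :
  Omega q (k + j) x c d * Delta_factor q (k + j) c d k = kernel q x c d k j.
Proof.
have Q n := qpoch_neq0 n q1.
have CD n := qpoch_neq0 n cd1.
have X n := qpoch_neq0 n xq1.
(* A vanishing factor would mean [d = q ^+ (k + j - i)] with [i < k], a positive exponent, which
   [d1] excludes. *)
have D : qpoch q (d * q ^- (k + j)) k != 0.
  apply/prodf_neq0 => i _; rewrite subr_eq0 eq_sym.
  have ikj : (k + j = i + (k - i + j).-1.+1)%N.
    by have := ltn_ord i; lia.
  apply: contra (d1 (k - i + j).-1) => /eqP dE; apply/eqP.
  rewrite -[RHS]mul1r -dE ikj exprD.
  by field; rewrite !expf_neq0.
have CDk : qpoch q (c * d * q ^+ (k + j + 2)) k != 0.
  apply: qpoch_neq0 => n.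
  by rewrite addn2 exprS !mulrA -mulrA -exprD.
have := qpoch_reflect d j k q0.
rewrite /Omega /Delta_factor /kernel.
have -> : qpoch q (c * d * q) (k + j + k).+1 =
    qpoch q (c * d * q) (k + j).+1 * qpoch q (c * d * q ^+ (k + j + 2)) k.
  by rewrite -addSn qpochD addn2 [q ^+ (k + j).+2]exprS mulrA.
move=> E.
have {}E : qpoch q (q ^- (k + j)) k * qpoch_div q q d (k + j) =
  qpoch q (d * q ^- (k + j)) k * qpoch_div q q d j * qpoch q q (k + j)
  / qpoch q q j by rewrite -E mulfK.
transitivity ((1 - x * d) * (1 - c * q ^+ (2 * (k + j) + 2)) *
  (qpoch q (q ^- (k + j)) k * qpoch_div q q d (k + j)) *
  (qpoch_div q (c * q) x (k + j) * qpoch q (c * d * q) k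
   * qpoch q (c * q ^+ (k + j + 2)) k) /
  (qpoch q (c * d * q) (k + j).+1 * qpoch q (x * q) (k + j).+1
   * (qpoch q q k * qpoch q (c * d * q ^+ (k + j + 2)) k
      * qpoch q (d * q ^- (k + j)) k))).
  field.
  by rewrite ?Q ?CD ?X ?D ?CDk.
rewrite E; field.
by rewrite ?Q ?CD ?X ?D ?CDk.
Qed.

(* Minus the value at n = k + j + 1 of the Wilf-Zeilberger certificate for the
   recurrence in k satisfied by the sums of the kernel over n. *)
Definition kernel_cert k j : K :=
  (1 - x * d) * (1 - c * d * q ^+ (2 * k + 2))
  * (qpoch_div q q d j * qpoch_div q (c * q) x (k + j).+1)
  * (qpoch q q (k + j).+1 * qpoch q (c * d * q) k
     * qpoch q (c * q ^+ (k + j + 2)) k.+1)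
  / (qpoch q q j * qpoch q q k.+1
     * (qpoch q (c * d * q) (k + j + k).+2 * qpoch q (x * q) (k + j).+1)).

(** The sum for [k] starts at [n = k], the sum for [k.+1] one index later. This boundary value
    accounts for the extra term. *)
Lemma kernel_cert0 k :
  kernel_cert k 0 = (x - c * q ^+ k.+1) * kernel q x c d k 0.
Proof.
rewrite /kernel_cert /kernel !addn0.
rewrite [qpoch q q k.+1]qpochS.
rewrite [qpoch q (c * q ^+ (k + 2)) k.+1]qpochS.
rewrite [qpoch q (c * d * q) (k + k).+2]qpochS qpoch_divS.
rewrite !(exprD, exprS, mul2n, =^~ addnn).
have := q1 k; have := qpoch_neq0 k q1; have := cd1 (k + k).+1.
have := qpoch_neq0 (k + k).+1 cd1; have := qpoch_neq0 k.+1 xq1.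
rewrite !(exprD, exprS, qpoch0, qpoch_div0).
move: (q ^+ k) (qpoch q (c * d * q) (k + k).+1) (qpoch q _ k.+1) => Z A B.
move=> B0 A0 h1 C0 h2; field.
by rewrite B0 A0 h1 C0 h2.
Qed.

(** Both kernels belong to [n = k + j + 1]. Once the shifted factorials are reduced to common ones,
    a rational identity in [q], [q ^+ k], [q ^+ j], [x], [c] and [d] remains. *)
Lemma kernel_certS k j :
  (1 - x * d * q ^+ k.+1) * kernel q x c d k.+1 j + kernel_cert k j.+1 =
  (x - c * q ^+ k.+1) * kernel q x c d k j.+1 + kernel_cert k j.
Proof.
rewrite /kernel_cert /kernel.
have -> : (k.+1 + j + k.+1).+1 = (k + j + k).+3 by lia.
rewrite !addnS !addSn !addn0.
have eZ2 : c * q ^+ (k + j).+3 = c * q ^+ (k + j).+2 * q.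
  by rewrite -mulrA -exprSr.
rewrite [qpoch q (c * q ^+ (k + j).+2) k.+1]qpochSl -eZ2.
rewrite [qpoch q (c * q ^+ (k + j).+3) k.+1]qpochS.
rewrite [qpoch q q k.+1]qpochS [qpoch q q j.+1]qpochS.
rewrite [qpoch q q (k + j).+2]qpochS [qpoch q (c * d * q) k.+1]qpochS.
rewrite [qpoch q (c * d * q) _.+3]qpochS [qpoch q (x * q) _.+2]qpochS.
rewrite [qpoch_div q q d j.+1]qpoch_divS [qpoch_div q _ x _.+2]qpoch_divS.
have := q1 k; have := q1 j; have := qpoch_neq0 k q1; have := qpoch_neq0 j q1.
have := cd1 (k + j + k).+2; have := qpoch_neq0 (k + j + k).+2 cd1.
have := qpoch_neq0 (k + j).+1 xq1; have := xq1 (k + j).+1.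
rewrite !mul2n -!addnn.
rewrite !(exprD, exprS, addnS, addSn).
move: (qpoch q (c * d * q) (k + j + k).+2) (qpoch q (x * q) _) => A B.
move: (qpoch q q k) (qpoch q q j) (qpoch q q _) (qpoch_div q q _ _) => Qk Qj Qn D.
move: (qpoch_div q _ _ _) (qpoch q _ k) (qpoch q _ k) => X E F.
move: (q ^+ k) (q ^+ j) => Z Y.
move=> h1 B0 A0 h2 Qj0 Qk0 h3 h4.
field.
by rewrite h1 B0 A0 h2 Qj0 Qk0 h3 h4.
Qed.

(** For [k = 0] each kernel is the difference of two consecutive values of the product on the
    right. *)
Lemma kernel_sum0 n : \sum_(j < n) kernel q x c d 0 j =
  1 - qpoch_div q q d n * qpoch_div q (c * q) x n
      / (qpoch q (c * d * q) n * qpoch q (x * q) n).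
Proof.
elim: n => [|n IHn]; first by rewrite big_ord0 !qpoch0 !qpoch_div0 !mulr1 divr1 subrr.
rewrite big_ord_recr /= IHn /kernel !add0n addn0 !qpoch0 !qpoch_divS !qpochS.
rewrite mul2n -addnn exprD exprD.
have := q1 n; have := qpoch_neq0 n q1; have := cd1 n; have := qpoch_neq0 n cd1.
have := xq1 n; have := qpoch_neq0 n xq1.
by move=> h1 h2 h3 h4 h5 h6; field; rewrite h1 h2 h3 h4 h5.
Qed.

(** Telescoping of [kernel_certS] over [j]. The upper limits differ by one because both sums stop at
    the same index [k + n] of the original series. *)
Lemma kernel_sumS k n :
  (1 - x * d * q ^+ k.+1) * \sum_(j < n) kernel q x c d k.+1 j =
  (x - c * q ^+ k.+1) * \sum_(j < n.+1) kernel q x c d k j - kernel_cert k n.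
Proof.
elim: n => [|n IHn].
  by rewrite big_ord_recr !big_ord0 /= add0r mulr0 kernel_cert0 subrr.
rewrite big_ord_recr /= mulrDr IHn [in RHS]big_ord_recr /=.
set S := \sum_(_ < _) _; have E := kernel_certS k n.
rewrite -[X in _ - _ + X](addrK (kernel_cert k n.+1)) E; ring.
Qed.

End KernelSums.
End QAlgebra.

(** * Bounds for q-shifted factorials *)

Local Notation N := Normc.normc.

Lemma expr_prod_ord (K : pzSemiRingType) (z : K) n : z ^+ n = \prod_(i < n) z.
Proof. by rewrite prodr_const card_ord. Qed.

Lemma le_of_eq (R : numDomainType) (x y : R) : x = y -> x <= y.
Proof. by move->. Qed.

Section ComplexNorm.
Variable R : realType.
Implicit Types (z w : R[i]) (n : nat).

Lemma normr_normc z : `|z| = (N z)%:C%C.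
Proof. by []. Qed.

Lemma normc_ge0 z : 0 <= N z.
Proof. by rewrite -lecR -normr_normc normr_ge0. Qed.

Lemma normc_le_distD z w : N (z - w) <= N z + N w.
Proof. by rewrite -[N w]normcN le_normcD. Qed.

Lemma normc_le_dist z w : N z - N w <= N (z - w).
Proof. by rewrite lerBlDr (le_trans _ (le_normcD _ _))// subrK. Qed.

Lemma normc_prod (I : Type) (s : seq I) (P : pred I) (F : I -> R[i]) :
  N (\prod_(i <- s | P i) F i) = \prod_(i <- s | P i) N (F i).
Proof.
apply: (big_morph (@Normc.normc R)) => [z w|]; first exact: Normc.normcM.
exact: Normc.normc1.
Qed.

Lemma normcX z n : N (z ^+ n) = N z ^+ n.
Proof.
elim: n => [|n IHn]; first by rewrite !expr0 Normc.normc1.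
by rewrite !exprS Normc.normcM IHn.
Qed.

Lemma le_normc_sum (I : Type) (s : seq I) (P : pred I) (F : I -> R[i]) :
  N (\sum_(i <- s | P i) F i) <= \sum_(i <- s | P i) N (F i).
Proof.
apply: (big_ind2 (fun z r => N z <= r)) => [|z r w s' zr ws|//].
  by rewrite Normc.normc0.
exact: le_trans (le_normcD _ _) (lerD zr ws).
Qed.

Lemma normc_gt0 z : z != 0 -> 0 < N z.
Proof.
move=> z0; rewrite lt_neqAle normc_ge0 andbT eq_sym.
by apply: contra z0 => /eqP/Normc.eq0_normc ->.
Qed.

Lemma normcM_le z w (a b : R) : N z <= a -> N w <= b -> N (z * w) <= a * b.
Proof. by move=> za wb; rewrite Normc.normcM ler_pM ?normc_ge0. Qed.

Lemma normc_div_le z w (a e : R) : 0 < e -> N z <= a -> e <= N w ->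
  N (z / w) <= a / e.
Proof.
move=> e0 za ew; rewrite normcM_le// Normc.normcV lef_pV2// posrE//.
exact: lt_le_trans ew.
Qed.

Lemma geometric_sum_le (Q : R) n : 0 <= Q -> Q < 1 ->
  \sum_(j < n) Q ^+ j <= (1 - Q)^-1.
Proof.
move=> Q0 Q1; have Q2 : 0 < 1 - Q by rewrite subr_gt0.
rewrite -[leRHS]mul1r ler_pdivlMr// mulrC -opprB mulNr -subrX1 opprB gerBl.
exact: exprn_ge0.
Qed.

Lemma geometric_small (C Q e : R) : 0 <= Q -> Q < 1 -> 0 < e ->
  exists n0, forall n, (n0 <= n)%N -> C * Q ^+ n < e.
Proof.
move=> Q0 Q1 e0; have Q1' : `|Q| < 1 by rewrite ger0_norm.
have /cvgrPdist_lt/(_ _ e0)[n0 _ H] := cvg_geometric C Q1'.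
exists n0 => n /H /=; rewrite sub0r normrN; exact: le_lt_trans (ler_norm _).
Qed.

(** By [1 + y <= expR y] in each factor, the exponent becomes a geometric sum. *)
Lemma prod_1D_le (M Q : R) n : 0 <= M -> 0 <= Q -> Q < 1 ->
  \prod_(j < n) (1 + M * Q ^+ j) <= expR (M / (1 - Q)).
Proof.
move=> M0 Q0 Q1.
apply: (@le_trans _ _ (expR (\sum_(j < n) M * Q ^+ j))).
  rewrite expR_sum; apply: ler_prod => j _.
  by rewrite expR_ge1Dx andbT addr_ge0// mulr_ge0// exprn_ge0.
by rewrite ler_expR -mulr_sumr ler_wpM2l// geometric_sum_le.
Qed.

Section Bounds.
Variable q : R[i].
Hypothesis q1 : N q < 1.
Implicit Types (a x c d : R[i]) (j k : nat).

Let q_ge0 : 0 <= N q. Proof. exact: normc_ge0. Qed.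

Lemma normc_expq_le1 n : N (q ^+ n) <= 1.
Proof. by rewrite normcX exprn_ile1// ltW. Qed.

Lemma qpoch_le a n : N (qpoch q a n) <= expR (N a / (1 - N q)).
Proof.
rewrite normc_prod (le_trans _ (prod_1D_le n (normc_ge0 a) q_ge0 q1))//.
apply: ler_prod => j _; rewrite normc_ge0/=.
by rewrite (le_trans (normc_le_distD _ _))// Normc.normc1 Normc.normcM normcX.
Qed.

Lemma qpoch_le_uniform a b n : N a <= N b ->
  N (qpoch q a n) <= expR (N b / (1 - N q)).
Proof.
move=> ab; rewrite (le_trans (qpoch_le _ _))// ler_expR ler_wpM2r//.
by rewrite invr_ge0 subr_ge0 ltW.
Qed.

(** Weierstrass's inequality: the product of the [|1 - y_j|] is at least [1 - \sum_j |y_j|], and the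
    assumption on [a] keeps this sum at most one half. *)
Lemma qpoch_lbound_small a n : N a <= (1 - N q) / 2 ->
  2^-1 <= N (qpoch q a n).
Proof.
move=> a1; have Q0 : 0 < 1 - N q by rewrite subr_gt0.
have aS k : N a * \sum_(j < k) N q ^+ j <= 2^-1.
  rewrite (le_trans (ler_wpM2l (normc_ge0 _) (geometric_sum_le k q_ge0 q1)))//.
  by rewrite ler_pdivrMr// mulrC.
suff : 1 - N a * \sum_(j < n) N q ^+ j <= N (qpoch q a n).
  by apply: le_trans; have := aS n; lra.
elim: n => [|n IHn]; first by rewrite big_ord0 qpoch0 mulr0 subr0 Normc.normc1.
rewrite qpochS Normc.normcM.
have h1 : 1 - N a * N q ^+ n <= N (1 - a * q ^+ n).
  by rewrite -normcX -Normc.normcM (le_trans _ (normc_le_dist _ _))// Normc.normc1.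
have h2 := aS n.+1.
have h4 : 0 <= N a * N q ^+ n by rewrite mulr_ge0 ?exprn_ge0 ?normc_ge0.
have h5 : 0 <= N a * \sum_(j < n) N q ^+ j.
  by rewrite mulr_ge0 ?normc_ge0// sumr_ge0// => j _; rewrite exprn_ge0.
rewrite big_ord_recr/= mulrDr in h2 *.
apply: (@le_trans _ _ ((1 - N a * \sum_(j < n) N q ^+ j) * (1 - N a * N q ^+ n))).
  by nra.
by rewrite ler_pM//; lra.
Qed.

(** After finitely many factors [qpoch_lbound_small] applies; the induction on [J] peels these off
    one at a time, each being nonzero. *)
Lemma qpoch_lbound a : (forall j, 1 - a * q ^+ j != 0) ->
  exists2 e : R, 0 < e & forall n, e <= N (qpoch q a n).
Proof.
have Q0 : 0 < (1 - N q) / 2 by rewrite divr_gt0 ?subr_gt0.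
have [J /(_ J (leqnn J))/ltW] := geometric_small (N a) q_ge0 q1 Q0.
elim: J a => [|J IHJ] a aJ a0.
  exists 2^-1; first by rewrite invr_gt0.
  by move=> n; apply: qpoch_lbound_small; rewrite expr0 mulr1 in aJ.
have [|j|e e0 eP] := IHJ (a * q).
- by rewrite Normc.normcM -mulrA -exprS.
- by rewrite -mulrA -exprS.
(* The minimum with 1 covers the empty product [n = 0]. *)
exists (Num.min 1 (N (1 - a) * e)) => [|[|n]].
- by rewrite lt_min ltr01 mulr_gt0// normc_gt0//; have := a0 0; rewrite mulr1.
- by rewrite qpoch0 Normc.normc1 ge_min lexx.
- by rewrite qpochSl Normc.normcM ge_min ler_wpM2l ?normc_ge0 ?orbT.
Qed.

(** Each factor is at most [r (1 + |a| |q|^j / r)]. A radius [r] larger than [|x|] is allowed so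
    that [x = 0] is covered. *)
Lemma qpoch_div_le a x (r : R) n : 0 < r -> N x <= r ->
  N (qpoch_div q a x n) <= r ^+ n * expR (N a / r / (1 - N q)).
Proof.
move=> r0 xr; have ar : 0 <= N a / r by rewrite divr_ge0 ?normc_ge0// ltW.
rewrite (le_trans _ (ler_wpM2l (exprn_ge0 n (ltW r0)) (prod_1D_le n ar q_ge0 q1)))//.
rewrite expr_prod_ord -big_split normc_prod/=.
apply: ler_prod => j _; rewrite normc_ge0/= mulrDr mulr1 mulrA.
rewrite (mulrC r) divfK ?gt_eqF//.
by rewrite (le_trans (normc_le_distD _ _))// Normc.normcM normcX lerD.
Qed.

End Bounds.
End ComplexNorm.

(** * Geometric bounds for the kernel *)

Section KernelEstimates.
Variables (R : realType) (q x c d : R[i]).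
Hypothesis q0 : q != 0.
Hypothesis q_lt1 : N q < 1.
Hypothesis cd_ok : forall n, c * d != q ^- n.+1.
Hypothesis x_lt1 : N x < 1.
Hypothesis xd_ok : N (x * d) < 1 \/ exists M : nat, x = c * q ^+ M.+1.

Let X k := qpoch_div q (c * q) x k.

Lemma one_sub_neq0 (z : R[i]) : N z < 1 -> 1 - z != 0.
Proof.
by apply: contraTneq => /subr0_eq <-; rewrite Normc.normc1 ltxx.
Qed.

Lemma one_sub_expr_neq0 (z : R[i]) n : N z < 1 -> 1 - z * q * q ^+ n != 0.
Proof.
move=> z1; rewrite one_sub_neq0// -mulrA -exprS Normc.normcM.
rewrite (le_lt_trans _ z1)// ler_piMr ?normc_ge0// normc_expq_le1//.
Qed.

Lemma one_sub_q_neq0 n : 1 - q * q ^+ n != 0.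
Proof.
rewrite one_sub_neq0// Normc.normcM (le_lt_trans _ q_lt1)//.
by rewrite ler_piMr ?normc_ge0// normc_expq_le1.
Qed.

Lemma one_sub_cd_neq0 n : 1 - c * d * q * q ^+ n != 0.
Proof.
rewrite subr_eq0 eq_sym -mulrA -exprS; apply: contra (cd_ok n) => /eqP cdE.
by rewrite -[X in _ == X]mul1r -cdE mulfK// expf_neq0.
Qed.

(** If [x = c q^{M+1}], then [x d q^{n+1} = c d q^{M+n+2}], and the hypothesis on [c * d]
    applies. *)
Lemma one_sub_xd_neq0 n : 1 - x * d * q * q ^+ n != 0.
Proof.
case: xd_ok => [|[M ->]]; first exact: one_sub_expr_neq0.
have := one_sub_cd_neq0 (n + M.+1).
by rewrite exprD; congr (1 - _ != 0); ring.
Qed.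

Let q1 := one_sub_q_neq0.
Let cd1 := one_sub_cd_neq0.
Let xq1 n : 1 - x * q * q ^+ n != 0 := one_sub_expr_neq0 n x_lt1.

(** The factor [N (X k)] is kept unestimated: later it is combined with [phi_term] into [lhs_numer],
    whose decay is known. *)
Lemma qpoch_div_prod_le (r s : R) : 0 < r -> N d <= r -> 0 < s -> N x <= s ->
  exists2 C : R, 0 <= C & forall k j,
    N (qpoch_div q q d j * X (k + j)) <= C * N (X k) * (r * s) ^+ j.
Proof.
move=> r0 dr s0 xs.
exists (expR (N q / r / (1 - N q)) * expR (N c / s / (1 - N q))).
  by rewrite mulr_ge0 ?expR_ge0.
move=> k j; rewrite /X qpoch_divD.
have h1 := qpoch_div_le q_lt1 q j r0 dr.
have h2 : N (qpoch_div q (c * q * q ^+ k) x j) <=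
    s ^+ j * expR (N c / s / (1 - N q)).
  rewrite (le_trans (qpoch_div_le q_lt1 _ j s0 xs))//.
  rewrite ler_wpM2l ?exprn_ge0 ?(ltW s0)// ler_expR.
  rewrite !ler_wpM2r ?invr_ge0 ?(ltW s0) ?subr_ge0 ?(ltW q_lt1)//.
  by rewrite -mulrA -exprS Normc.normcM ler_piMr ?normc_ge0// normc_expq_le1.
rewrite (le_trans (normcM_le h1 (normcM_le (lexx _) h2)))// exprMn.
by apply: le_of_eq; ring.
Qed.

Lemma qpoch_div_prod_geometric : exists2 r : R, 0 < r < 1 &
  exists2 C : R, 0 <= C & forall k j,
    N (qpoch_div q q d j * X (k + j)) <= C * N (X k) * r ^+ j.
Proof.
have [d0 x0] := (normc_ge0 d, normc_ge0 x).
case: xd_ok => [|[M xE]].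
  rewrite Normc.normcM => xd1; have xd0 : 0 <= N x * N d by rewrite mulr_ge0.
  (* [(|d| + e)(|x| + e) = |x d| + e (|x| + |d| + e)], and as [e <= 1] this is less than
     [|x d| + e (|x| + |d| + 2) = 1]. *)
  pose e := (1 - N x * N d) / (N x + N d + 2).
  have s0 : 0 < N x + N d + 2 by lra.
  have e0 : 0 < e by rewrite divr_gt0// subr_gt0.
  have eE : e * (N x + N d + 2) = 1 - N x * N d by rewrite divfK// gt_eqF.
  have e1 : e <= 1 by rewrite ler_pdivrMr//; lra.
  have [||||C C0 CP] := @qpoch_div_prod_le (N d + e) (N x + e); [lra..|].
  exists ((N d + e) * (N x + e)); last by exists C.
  by apply/andP; split; nra.
have [||||C C0 CP] := @qpoch_div_prod_le (N d + 1) (N x + 1); [lra..|].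
set b := (N d + 1) * (N x + 1) in CP.
have b1 : 1 <= b by rewrite /b; nra.
(* Terms with [k + j > M] vanish, so only [j <= M] matters. There [b ^+ j] is [(2 * b) ^+ j] times
   [2^-1 ^+ j], and [(2 * b) ^+ M] goes into the constant. *)
exists 2^-1; first by apply/andP; split; lra.
exists (C * (2 * b) ^+ M) => [|k j].
  by rewrite mulr_ge0 ?exprn_ge0//; lra.
have X0 := normc_ge0 (X k).
have [Mkj|kjM] := ltnP M (k + j).
  have xqE : x = c * q * q ^+ M by rewrite xE exprS mulrA.
  rewrite /X (qpoch_div_eq0 Mkj xqE).
  rewrite mulr0 Normc.normc0 !mulr_ge0// ?exprn_ge0//; lra.
rewrite (le_trans (CP k j))//.
have -> : C * (2 * b) ^+ M * N (X k) * 2^-1 ^+ j =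
    C * N (X k) * ((2 * b) ^+ M * 2^-1 ^+ j) by ring.
rewrite ler_wpM2l ?mulr_ge0//.
have -> : b ^+ j = (2 * b) ^+ j * 2^-1 ^+ j.
  by rewrite -exprMn mulrAC divff ?mul1r// pnatr_eq0.
have h2 : 0 <= 2^-1 ^+ j :> R by rewrite exprn_ge0.
rewrite ler_wpM2r// ler_weXn2l//; first by lra.
exact: leq_trans (leq_addl _ _) kjM.
Qed.

Lemma normc_1B_le (z : R[i]) : N (1 - z) <= 1 + N z.
Proof. by rewrite (le_trans (normc_le_distD _ _))// Normc.normc1. Qed.

Lemma normc_1BM_le (z : R[i]) n : N (1 - z * q ^+ n) <= 1 + N z.
Proof.
rewrite (le_trans (normc_1B_le _))// lerD2l Normc.normcM.
by rewrite ler_piMr ?normc_ge0// normc_expq_le1.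
Qed.

(** The [qpoch] in the numerators are bounded and those in the denominators bounded away from 0, so
    the decay in [j] comes from [qpoch_div_prod_geometric]. The certificate has one more factor
    [x - c q^{k+j+1}], at most [|x| + |c|]. *)
Lemma kernel_estimate : exists2 r : R, 0 < r < 1 &
  exists2 C : R, 0 <= C & forall k j,
    N (kernel q x c d k j) <= C * N (X k) * r ^+ j /\
    N (kernel_cert q x c d k j) <= C * N (X k) * r ^+ j.
Proof.
have [r r01 [C C0 CP]] := qpoch_div_prod_geometric; exists r => //.
have [e e0 eP] := qpoch_lbound q_lt1 q1.
have [f f0 fP] := qpoch_lbound q_lt1 cd1.
have [g g0 gP] := qpoch_lbound q_lt1 xq1.
have den k l m n : e * e * (f * g) <=
    N (qpoch q q k * qpoch q q l * (qpoch q (c * d * q) m * qpoch q (x * q) n)).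
  by rewrite !Normc.normcM !ler_pM ?mulr_ge0// ltW.
have den0 : 0 < e * e * (f * g) by rewrite !mulr_gt0.
pose B := expR (N q / (1 - N q)) * expR (N (c * d * q) / (1 - N q))
          * expR (N c / (1 - N q)).
have num k l m n : N (qpoch q q k * qpoch q (c * d * q) l
    * qpoch q (c * q ^+ m) n) <= B.
  rewrite !normcM_le ?qpoch_le// qpoch_le_uniform// Normc.normcM.
  by rewrite ler_piMr ?normc_ge0// normc_expq_le1.
pose A1 := (1 + N (x * d)) * (1 + N c).
pose A2 := (1 + N (x * d)) * (1 + N (c * d)).
have [r0 _] := andP r01.
have rj j : 0 <= r ^+ j by rewrite exprn_ge0// ltW.
have B0 : 0 <= B by rewrite !mulr_ge0 ?expR_ge0.
have A10 : 0 <= A1 by rewrite mulr_ge0 ?addr_ge0 ?normc_ge0.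
have A20 : 0 <= A2 by rewrite mulr_ge0 ?addr_ge0 ?normc_ge0.
pose C1 := A1 * C * B / (e * e * (f * g)).
pose C2 := A2 * (C * (N x + N c)) * B / (e * e * (f * g)).
have C10 : 0 <= C1 := divr_ge0 (mulr_ge0 (mulr_ge0 A10 C0) B0) (ltW den0).
have xc0 : 0 <= N x + N c by rewrite addr_ge0 ?normc_ge0.
have C20 : 0 <= C2 := divr_ge0 (mulr_ge0 (mulr_ge0 A20 (mulr_ge0 C0 xc0)) B0) (ltW den0).
exists (C1 + C2) => [|k j]; first exact: addr_ge0.
have Xr : 0 <= N (X k) * r ^+ j by rewrite mulr_ge0 ?normc_ge0.
split; rewrite -mulrA.
  apply: (@le_trans _ _ (C1 * (N (X k) * r ^+ j))); last first.
    by rewrite ler_wpM2r// lerDl.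
    rewrite /kernel.
    have h := normcM_le (normcM_le (normcM_le (normc_1B_le (x * d))
      (normc_1BM_le c (2 * (k + j) + 2))) (CP k j)) (num (k + j) k (k + j + 2) k).
    rewrite (le_trans (normc_div_le den0 h (den _ _ _ _)))//.
    by rewrite /C1 /A1; apply: le_of_eq; ring.
apply: (@le_trans _ _ (C2 * (N (X k) * r ^+ j))); last first.
  by rewrite ler_wpM2r// lerDr.
  rewrite /kernel_cert qpoch_divS [qpoch_div q q d j * _]mulrA.
  have hx : N (x - c * q * q ^+ (k + j)) <= N x + N c.
    rewrite (le_trans (normc_le_distD _ _))// lerD2l -mulrA -exprS Normc.normcM.
    by rewrite ler_piMr ?normc_ge0// normc_expq_le1.
  have h := normcM_le (normcM_le (normcM_le (normc_1B_le (x * d))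
    (normc_1BM_le (c * d) (2 * k + 2))) (normcM_le (CP k j) hx))
    (num (k + j).+1 k (k + j + 2) k.+1).
  rewrite (le_trans (normc_div_le den0 h (den _ _ _ _)))//.
  by rewrite /C2 /A2; apply: le_of_eq; ring.
Qed.

(** Induction on [k]: for [k = 0] the error is the explicit product in [kernel_sum0], and
    [kernel_sumS] carries limit and error from [k] to [k.+1]. The rate stays fixed; the constant
    depends on [k]. *)
Lemma kernel_sum_estimate : exists2 r : R, 0 < r < 1 &
  forall k, exists A : R, forall n,
    N (\sum_(j < n) kernel q x c d k j - X k / qpoch q (x * d * q) k)
      <= A * r ^+ n.
Proof.
have [r r01 [C C0 CP]] := kernel_estimate.
have [e e0 eP] := qpoch_lbound q_lt1 q1.
have [s s01 [D D0 DP]] := qpoch_div_prod_geometric.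
have [f f0 fP] := qpoch_lbound q_lt1 cd1.
have [g g0 gP] := qpoch_lbound q_lt1 xq1.
pose t := Num.max r s.
have [[r0 r1] [s0 s1]] := (andP r01, andP s01).
have rt : r <= t by rewrite le_max lexx.
have st : s <= t by rewrite le_max lexx orbT.
have t0 : 0 <= t by rewrite (le_trans _ rt)// ltW.
exists t; first by rewrite (lt_le_trans r0 rt) gt_max r1 s1.
elim=> [|k [A AP]].
  exists (D / (f * g)) => n.
  rewrite (kernel_sum0 q1 cd1 xq1) /X qpoch_div0 qpoch0 divr1 addrAC subrr add0r.
  rewrite normcN.
  have h := DP 0 n; rewrite add0n /X qpoch_div0 Normc.normc1 mulr1 in h.
  have den : f * g <= N (qpoch q (c * d * q) n * qpoch q (x * q) n).
    by rewrite Normc.normcM ler_pM// ltW.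
  rewrite (le_trans (normc_div_le (mulr_gt0 f0 g0) h den))// mulrAC.
  by rewrite ler_wpM2l ?divr_ge0 ?mulr_ge0 ?(ltW f0) ?(ltW g0)// lerXn2r// ?nnegrE ltW.
set z := 1 - x * d * q * q ^+ k.
have z0 : z != 0 := one_sub_xd_neq0 k.
have P0 : qpoch q (x * d * q) k != 0 := qpoch_neq0 k one_sub_xd_neq0.
exists ((N (x - c * q ^+ k.+1) * A * t + C * N (X k)) / N z) => n.
have zE : 1 - x * d * q ^+ k.+1 = z by rewrite /z exprS mulrA.
have := kernel_sumS q0 q1 cd1 xq1 k n; rewrite zE => E.
(* The limits satisfy the recurrence without the certificate, so subtracting them leaves a
   recurrence for the errors. *)
have {}E : \sum_(j < n) kernel q x c d k.+1 j - X k.+1 / qpoch q (x * d * q) k.+1 =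
    ((x - c * q ^+ k.+1) * (\sum_(j < n.+1) kernel q x c d k j
      - X k / qpoch q (x * d * q) k) - kernel_cert q x c d k n) / z.
  apply: (mulfI z0); rewrite mulrBr E /X qpoch_divS qpochS -/z exprS mulrA.
  by field; rewrite z0 P0.
rewrite E Normc.normcM Normc.normcV [leRHS]mulrAC ler_wpM2r ?invr_ge0 ?normc_ge0//.
rewrite [leRHS]mulrDl (le_trans (normc_le_distD _ _))// lerD//.
  have -> : N (x - c * q ^+ k.+1) * A * t * t ^+ n =
    N (x - c * q ^+ k.+1) * (A * t ^+ n.+1) by rewrite (exprS t); ring.
  by rewrite normcM_le.
rewrite (le_trans (CP k n).2)// ler_wpM2l ?mulr_ge0 ?normc_ge0//.
by rewrite lerXn2r// nnegrE ltW.
Qed.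
End KernelEstimates.

(** * Interchange of summations *)

Local Open Scope classical_set_scope.

Section ComplexLimits.
Variable R : realType.

Lemma ltc_realP (e : R[i]) : 0 < e -> exists2 r : R, 0 < r & e = r%:C%C.
Proof.
move=> e0; exists (complex.Re e); last by rewrite RRe_real// gtr0_real.
by rewrite -ltcR RRe_real// gtr0_real.
Qed.

Lemma cvgn_normcP (u : nat -> R[i]) (l : R[i]) :
  ((u : nat -> R[i]^o) @ \oo --> (l : R[i]^o)) <->
  forall e : R, 0 < e -> exists n0, forall n, (n0 <= n)%N -> N (l - u n) < e.
Proof.
split=> [/cvgrPdist_lt H e e0|H].
  have e0' : 0 < e%:C%C by rewrite ltcR.
  by have [n0 _ n0P] := H _ e0'; exists n0 => n /n0P; rewrite -ltcR.
apply/cvgrPdist_lt => _ /ltc_realP[e e0 ->].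
by have [n0 n0P] := H _ e0; exists n0 => // n /n0P; rewrite -ltcR.
Qed.

Lemma cvgn_prod (I : Type) (s : seq I) (u : I -> nat -> R[i]) (l : I -> R[i]) :
  (forall i, (u i : nat -> R[i]^o) @ \oo --> (l i : R[i]^o)) ->
  ((fun n => \prod_(i <- s) u i n) : nat -> R[i]^o) @ \oo -->
  (\prod_(i <- s) l i : R[i]^o).
Proof.
move=> ul; elim: s => [|i s IHs].
  rewrite big_nil; under eq_fun do rewrite big_nil; exact: cvg_cst.
rewrite big_cons; under eq_fun do rewrite big_cons.
exact: (cvgM (ul i) IHs).
Qed.
End ComplexLimits.

Lemma bernoulli_1B (R : realDomainType) (y : R) (k : nat) : 0 <= y <= 1 ->
  1 - k%:R * y <= (1 - y) ^+ k.
Proof.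
case/andP=> y0 y1; elim: k => [|k IHk]; first by rewrite mul0r subr0 expr0.
rewrite exprS; have y2 : 0 <= 1 - y by rewrite subr_ge0.
apply: le_trans (ler_wpM2l y2 IHk).
have : 0 <= k%:R * y * y by rewrite !mulr_ge0.
by rewrite -natr1; lra.
Qed.

(** * Cubes of multi-indices and geometric tails *)

Section Boxes.
Variable m : nat.
Implicit Types (L : nat) (A B : {fset {ffun 'I_m -> nat}}).

Definition ffun_nat L (g : {ffun 'I_m -> 'I_L}) : {ffun 'I_m -> nat} :=
  [ffun i => val (g i)].

Lemma ffun_nat_inj L : injective (@ffun_nat L).
Proof.
by move=> g h /ffunP gh; apply/ffunP => i; apply: val_inj; have := gh i; rewrite !ffunE.
Qed.

Definition box L : {fset {ffun 'I_m -> nat}} :=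
  [fset n in [seq ffun_nat g | g : {ffun 'I_m -> 'I_L}]]%fset.

Lemma mem_box L n : (n \in box L) = [forall i, (n i < L)%N].
Proof.
rewrite in_fset.
apply/fintype.imageP/forallP => [[g _ ->] i|H]; first by rewrite ffunE/= ltn_ord.
exists [ffun i => Ordinal (H i)] => //.
by apply/ffunP => i; rewrite !ffunE.
Qed.

Lemma sum_box (V : nmodType) L (F : {ffun 'I_m -> nat} -> V) :
  \sum_(n <- box L) F n = \sum_(g : {ffun 'I_m -> 'I_L}) F (ffun_nat g).
Proof.
rewrite (perm_big [seq ffun_nat g | g : {ffun 'I_m -> 'I_L}])/=; last first.
  apply: uniq_perm; [exact: fset_uniq | | by move=> n; rewrite !inE].
  by rewrite map_inj_uniq ?enum_uniq//; exact: ffun_nat_inj.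
by rewrite big_map big_enum.
Qed.

Lemma sum_box_prod (K : comPzSemiRingType) L (F : 'I_m -> nat -> K) :
  \sum_(n <- box L) \prod_i F i (n i) = \prod_i \sum_(j < L) F i j.
Proof.
rewrite sum_box bigA_distr_bigA; apply: eq_bigr => g _.
by apply: eq_bigr => i _; rewrite ffunE.
Qed.

(** Cubes are cofinal: the sum of all entries, each increased by one, exceeds every coordinate of
    every point of [A]. *)
Lemma fsubset_box A L : exists2 M, (L <= M)%N & (A `<=` box M)%fset.
Proof.
exists (L + \sum_(n <- A) \sum_i (n i).+1)%N; first exact: leq_addr.
apply/fsubsetP => n nA; rewrite mem_box; apply/forallP => i.
rewrite (big_fsetD1 n)//= (bigD1 i)//=.
by rewrite -!addnA addnCA leq_addr.
Qed.

Lemma fset_filter_sub (A B : {fset {ffun 'I_m -> nat}}) :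
  (A `<=` B)%fset -> [fset x in B | x \in A]%fset = A.
Proof.
move=> /fsubsetP AB; apply/fsetP => n; rewrite !inE /=.
by apply/andP/idP => [[]|nA] //; split => //; exact: AB.
Qed.

Lemma sum_box_split (V : nmodType) L A (F : {ffun 'I_m -> nat} -> V) :
  (box L `<=` A)%fset -> \sum_(n <- A) F n =
  \sum_(n <- box L) F n + \sum_(n <- [fset x in A | x \notin box L]%fset) F n.
Proof.
move=> LA; rewrite (big_fsetID _ (mem (box L)))/=; congr (_ + _).
by rewrite fset_filter_sub.
Qed.

Lemma ler_sum_fset (R : numDomainType) A B (w : {ffun 'I_m -> nat} -> R) :
  (forall n, 0 <= w n) -> (A `<=` B)%fset ->
  \sum_(n <- A) w n <= \sum_(n <- B) w n.
Proof.
move=> w0 AB; rewrite [leRHS](big_fsetID _ (mem A))/= fset_filter_sub//.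
by rewrite lerDl sumr_ge0.
Qed.

Section Tail.
Variables (R : realType) (t : R).
Hypothesis t01 : 0 < t < 1.

Let w (n : {ffun 'I_m -> nat}) : R := \prod_i t ^+ n i.

Definition box_tail : R := m%:R * (1 - t)^-1 ^+ m.

(** The whole of [A] contributes at most [(1 - t)^{-m}] and the cube exactly
    [(1 - t)^{-m} (1 - t^L)^m]. Bernoulli's inequality bounds the difference, whence the factor [m]
    in [box_tail]. *)
Lemma sum_box_tail A L : (box L `<=` A)%fset ->
  \sum_(n <- [fset x in A | x \notin box L]%fset) w n <= box_tail * t ^+ L.
Proof.
move=> LA; have [t0 t1] := andP t01.
have w0 n : 0 <= w n by rewrite prodr_ge0// => i _; rewrite exprn_ge0// ltW.
have wbox M : \sum_(n <- box M) w n = (\sum_(j < M) t ^+ j) ^+ m.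
  by rewrite (sum_box_prod _ (fun _ j => t ^+ j)) prodr_const card_ord.
have g0 : 0 <= (1 - t)^-1 by rewrite invr_ge0 subr_ge0 ltW.
have wA : \sum_(n <- A) w n <= (1 - t)^-1 ^+ m.
  have [M _ AM] := fsubset_box A 0; rewrite (le_trans (ler_sum_fset w0 AM))//.
  rewrite wbox lerXn2r ?nnegrE ?geometric_sum_le// ?(ltW t0)//.
  by rewrite sumr_ge0// => j _; rewrite exprn_ge0// ltW.
rewrite (sum_box_split _ LA) wbox in wA.
have gL : \sum_(j < L) t ^+ j = (1 - t)^-1 * (1 - t ^+ L).
  rewrite -[1 - t ^+ L]opprB subrX1 -mulNr opprB mulKf// gt_eqF// subr_gt0//.
rewrite gL exprMn in wA.
have tL : 0 <= t ^+ L <= 1 by rewrite exprn_ge0 ?exprn_ile1// ltW.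
have := ler_wpM2l (exprn_ge0 m g0) (bernoulli_1B m tL).
rewrite /box_tail => h; rewrite -(lerD2l ((1 - t)^-1 ^+ m * (1 - t ^+ L) ^+ m)).
rewrite (le_trans wA)//.
move: ((1 - t)^-1 ^+ m) ((1 - t ^+ L) ^+ m) (t ^+ L) h => a b y.
by lra.
Qed.

Lemma sum_box_dist A L (c : R) (F : {ffun 'I_m -> nat} -> R[i]) :
  (forall n, N (F n) <= c * w n) -> (box L `<=` A)%fset ->
  N (\sum_(n <- A) F n - \sum_(n <- box L) F n) <= c * (box_tail * t ^+ L).
Proof.
move=> Fw LA; have [t0 t1] := andP t01.
have c0 : 0 <= c.
  have := Fw [ffun=> 0]; rewrite /w big1 => [|i _]; last by rewrite ffunE.
  by rewrite mulr1; apply: le_trans; exact: normc_ge0.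
rewrite (sum_box_split _ LA) addrAC subrr add0r.
rewrite (le_trans (le_normc_sum _ _ _))//.
rewrite (le_trans _ (ler_wpM2l c0 (sum_box_tail LA)))// mulr_sumr.
by apply: ler_sum => n _; exact: Fw.
Qed.
End Tail.

Section Interchange.
Variables (R : realType) (t : R) (i0 : 'I_m) (C : R).
Variables (v : nat -> R[i]) (T : 'I_m -> nat -> nat -> R[i]) (f : 'I_m -> nat -> R[i]).
Hypothesis t01 : 0 < t < 1.
Hypothesis T_tri : forall i k n, (n < k)%N -> T i k n = 0.
Hypothesis T_le : forall k (n : {ffun 'I_m -> nat}),
  N (v k * \prod_i T i k (n i)) <= C * t ^+ k * \prod_i t ^+ n i.
Hypothesis T_cvg : forall i k,
  ((fun n => \sum_(j < n) T i k j) : nat -> R[i]^o) @ \oo --> (f i k : R[i]^o).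

Let D := box_tail t.

(** On a larger cube [box M] the sum factors into one-index partial sums, which tend to the [f i k].
    The bound of [sum_box_dist] between [box L] and [box M] survives the limit in [M]. *)
Lemma box_prod_dist k L :
  N (v k * \prod_i f i k - \sum_(n <- box L) v k * \prod_i T i k (n i))
    <= C * t ^+ k * (D * t ^+ L).
Proof.
apply/ler_addgt0Pr => e e0.
have /cvgn_normcP/(_ _ e0)[n0 n0P] :
  ((fun n => v k * \prod_i \sum_(j < n) T i k j) : nat -> R[i]^o) @ \oo -->
  (v k * \prod_i f i k : R[i]^o).
  apply: cvgM; first exact: cvg_cst.
  by apply: (cvgn_prod (u := fun i n => \sum_(j < n) T i k j)) => i; exact: T_cvg.
pose M := maxn n0 L; have /n0P/ltW h1 : (n0 <= M)%N by rewrite leq_maxl.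
have LM : (box L `<=` box M)%fset.
  apply/fsubsetP => n; rewrite !mem_box => /forallP nL; apply/forallP => i.
  by rewrite (leq_trans (nL i))// leq_maxr.
have h2 := sum_box_dist t01 (T_le k) LM.
rewrite -mulr_sumr (sum_box_prod _ (fun i => T i k)) in h2.
rewrite [leRHS]addrC; apply: le_trans (lerD h1 h2).
by rewrite (le_trans _ (le_normcD _ _))// addrA subrK.
Qed.

Lemma has_sum_interchange (S : R[i]) :
  ((fun n => \sum_(k < n) v k * \prod_i f i k) : nat -> R[i]^o) @ \oo -->
    (S : R[i]^o) ->
  has_sum (fun n : {ffun 'I_m -> nat} =>
    \sum_(k < (n i0).+1) v k * \prod_i T i k (n i)) S.
Proof.
move=> /cvgn_normcP Scvg.
have FF : ProperFilter (@totally {ffun 'I_m -> nat}) := totally_filter.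
apply/cvgrPdist_lt => _ /ltc_realP[e e0 ->].
have [t0 t1] := andP t01; have t0' := ltW t0.
have C0 : 0 <= C.
  have := T_le 0 [ffun=> 0].
  rewrite [\prod_i t ^+ _]big1 => [|i _]; last by rewrite ffunE.
  by rewrite expr0 !mulr1; apply: le_trans; exact: normc_ge0.
have e2 : 0 < e / 2 by rewrite divr_gt0.
have [n0 n0P] := Scvg _ e2.
pose g := (1 - t)^-1.
(* The factor 2 pays for two errors of size [C * g * D * t ^+ L]: replacing the [f i k] by sums over
   the cube, and the points of [A] outside the cube. *)
have [n1 n1P] := geometric_small (2 * (C * g * D)) t0' t1 e2.
pose L := maxn n0 n1.
pose F (n : {ffun 'I_m -> nat}) := \sum_(k < (n i0).+1) v k * \prod_i T i k (n i).
have FC n : N (F n) <= C * g * \prod_i t ^+ n i.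
  rewrite (le_trans (le_normc_sum _ _ _))//.
  apply: (@le_trans _ _ (\sum_(k < (n i0).+1) C * t ^+ k * \prod_i t ^+ n i)).
    by apply: ler_sum => k _; exact: T_le.
  rewrite -mulr_suml -mulr_sumr ler_wpM2r//.
    by rewrite prodr_ge0// => i _; rewrite exprn_ge0.
  by rewrite ler_wpM2l// geometric_sum_le.
(* In the cube [n i0 < L], so the inner sum may run up to [L] for every [n]: by [T_tri] at [i0] the
   added terms vanish. *)
have Fbox : \sum_(n <- box L) F n =
    \sum_(k < L) \sum_(n <- box L) v k * \prod_i T i k (n i).
  rewrite exchange_big/=; apply: eq_big_seq => n; rewrite mem_box => /forallP nL.
  rewrite /F (big_ord_widen _ (fun k => v k * \prod_i T i k (n i)) (nL i0)).
  rewrite big_mkcond; apply: eq_bigr => k _; case: ltnP => // nk.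
  by rewrite (bigD1 i0)//= T_tri ?mul0r ?mulr0.
exists (box L) => // A /= LA; rewrite normr_normc ltcR /partial_sum.
rewrite -(big_seq_fsetE _ A xpredT F)/=.
have h1 := n0P L (leq_maxl _ _).
have h2 : N (\sum_(k < L) v k * \prod_i f i k - \sum_(n <- box L) F n)
    <= C * g * D * t ^+ L.
  rewrite Fbox -sumrB (le_trans (le_normc_sum _ _ _))//.
  apply: (@le_trans _ _ (\sum_(k < L) C * t ^+ k * (D * t ^+ L))).
    by apply: ler_sum => k _; exact: box_prod_dist.
  have D0 : 0 <= D * t ^+ L.
    by rewrite !mulr_ge0 ?exprn_ge0 ?invr_ge0 ?subr_ge0 ?(ltW t1).
  rewrite -mulr_suml -mulr_sumr -[leRHS]mulrA ler_wpM2r// ler_wpM2l//.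
  exact: geometric_sum_le.
have h3 := sum_box_dist t01 FC LA.
have h4 := n1P L (leq_maxr _ _).
rewrite -normcN opprB in h3.
apply: le_lt_trans (_ : _ <= N (S - \sum_(k < L) v k * \prod_i f i k) +
  N (\sum_(k < L) v k * \prod_i f i k - \sum_(n <- box L) F n) +
  N (\sum_(n <- box L) F n - \sum_(n <- A) F n)) _.
  rewrite -[S - _](subrK (\sum_(k < L) v k * \prod_i f i k)).
  apply: le_trans (lerD (le_normcD _ _) (lexx _)).
  apply: le_trans (le_normcD _ _).
  by apply: le_of_eq; congr N; ring.
by rewrite -/D mulrA in h3; lra.
Qed.
End Interchange.
End Boxes.

(** * Terms of the left-hand side *)

Section FiniteProducts.
Variables (R : realType) (S : Type) (I : finType) (F : I -> S -> R[i]) (g : I -> S -> R).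
Lemma normc_prod_le :
  (forall i, exists2 C : R, 0 <= C & forall s, N (F i s) <= C * g i s) ->
  exists2 C : R, 0 <= C & forall s, N (\prod_i F i s) <= C * \prod_i g i s.
Proof.
move=> FC; have /choice[C CP] : forall i, exists C : R,
    0 <= C /\ forall s, N (F i s) <= C * g i s.
  by move=> i; have [C C0 CP] := FC i; exists C.
exists (\prod_i C i) => [|s]; first by rewrite prodr_ge0// => i _; have [] := CP i.
rewrite normc_prod -big_split; apply: ler_prod => i _.
by rewrite normc_ge0/=; have [_] := CP i.
Qed.

Lemma normc_prod_ge : (forall i s, 0 <= g i s) ->
  (forall i, exists2 e : R, 0 < e & forall s, e * g i s <= N (F i s)) ->
  exists2 e : R, 0 < e & forall s, e * \prod_i g i s <= N (\prod_i F i s).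
Proof.
move=> g0 Fe; have /choice[e eP] : forall i, exists e : R,
    0 < e /\ forall s, e * g i s <= N (F i s).
  by move=> i; have [e e0 eP] := Fe i; exists e.
exists (\prod_i e i) => [|s]; first by rewrite prodr_gt0// => i _; have [] := eP i.
rewrite normc_prod -big_split; apply: ler_prod => i _.
by have [ei0 ei] := eP i; rewrite ei andbT mulr_ge0// ltW.
Qed.
End FiniteProducts.

(** With the weights [2 ^+ j], the summand [j = k] of the constant alone gives the bound at [k]. *)
Lemma finite_support_geometric (R : realType) (u : nat -> R[i]) M :
  (forall k, (M <= k)%N -> u k = 0) ->
  exists2 C : R, 0 <= C & forall k, N (u k) <= C * 2^-1 ^+ k.
Proof.
move=> uM; exists (\sum_(j < M) N (u j) * 2 ^+ j) => [|k].
  by rewrite sumr_ge0// => j _; rewrite mulr_ge0 ?normc_ge0 ?exprn_ge0.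
rewrite exprVn ler_pdivlMr ?exprn_gt0//.
have [Mk|kM] := leqP M k.
  rewrite uM// Normc.normc0 mul0r sumr_ge0// => j _.
  by rewrite mulr_ge0 ?normc_ge0 ?exprn_ge0.
rewrite (bigD1 (Ordinal kM))//= lerDl sumr_ge0// => j _.
by rewrite mulr_ge0 ?normc_ge0 ?exprn_ge0.
Qed.

Section LeftTerms.
Variables (R : realType) (q : R[i]) (r m : nat).
Variables (a b : 'I_r -> R[i]) (t : R[i]) (c x : 'I_m -> R[i]).
Hypothesis q_lt1 : N q < 1.
Hypothesis b_ok : forall i n, 1 - b i * q ^+ n != 0.
Hypothesis x_lt1 : forall i, N (x i) < 1.

(** The left-hand term without its denominators [(x_i d_i q;q)_k]: the quantity left over when the
    kernel bounds are multiplied by [phi_term]. *)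
Definition lhs_numer k : R[i] :=
  phi_term q a b t k * \prod_(i < m) qpoch_div q (c i * q) (x i) k.

Lemma qpochs_le p (e : 'I_p -> R[i]) :
  exists2 C : R, 0 <= C & forall k, N (qpochs q e k) <= C.
Proof.
have [i|C C0 CP] := @normc_prod_le R nat 'I_p (fun i => qpoch q (e i)) (fun _ _ => 1).
  exists (expR (N (e i) / (1 - N q))) => [|k]; first exact: expR_ge0.
  by rewrite /= mulr1 qpoch_le.
by exists C => // k; have := CP k; rewrite [X in _ * X]big1// mulr1.
Qed.

Lemma qpochs_ge p (e : 'I_p -> R[i]) : (forall i n, 1 - e i * q ^+ n != 0) ->
  exists2 C : R, 0 < C & forall k, C <= N (qpochs q e k).
Proof.
move=> e1.
have [|i|C C0 CP] := @normc_prod_ge R nat 'I_p (fun i => qpoch q (e i)) (fun _ _ => 1).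
- by move=> _ _; exact: ler01.
- by have [C C0 CP] := qpoch_lbound q_lt1 (e1 i); exists C => // k; rewrite /= mulr1.
by exists C => // k; have := CP k; rewrite [X in _ * X]big1// mulr1.
Qed.

(** The positive radii [s i] stand in for the [|x_i|], some of which may be 0. *)
Lemma lhs_numer_le (s : 'I_m -> R) : (forall i, 0 < s i) ->
  (forall i, N (x i) <= s i) ->
  exists2 C : R, 0 <= C & forall k, N (lhs_numer k) <= C * (N t * \prod_i s i) ^+ k.
Proof.
move=> s0 xs; have [A A0 AP] := qpochs_le a; have [B B0 BP] := qpochs_ge b_ok.
have [i|C C0 CP] := @normc_prod_le R nat 'I_m
    (fun i => qpoch_div q (c i * q) (x i)) (fun i k => s i ^+ k).
  exists (expR (N (c i * q) / s i / (1 - N q))) => [|k]; first exact: expR_ge0.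
  by rewrite [leRHS]mulrC qpoch_div_le.
exists (A / B * C) => [|k]; first by rewrite mulr_ge0// divr_ge0// ltW.
have h := normcM_le (normcM_le (normc_div_le B0 (AP k) (BP k))
  (lexx (N (t ^+ k)))) (CP k).
rewrite (le_trans h)// normcX exprMn prodrXl.
by apply: le_of_eq; ring.
Qed.

(** When no factor vanishes, the shifted factorials in the numerator stay away from 0. Arbitrarily
    small terms then force [|t| \prod_i |x_i| < 1]. *)
Lemma lhs_numer_ge : (forall i n, 1 - a i * q ^+ n != 0) ->
  (forall i n, x i != c i * q ^+ n.+1) -> (forall i, x i != 0) ->
  exists2 e : R, 0 < e & forall k, e * (N t * \prod_i N (x i)) ^+ k <= N (lhs_numer k).
Proof.
move=> a1 xc x0; have [A A0 AP] := qpochs_ge a1; have [B B0 BP] := qpochs_le b.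
have [|i|e e0 eP] := @normc_prod_ge R nat 'I_m
    (fun i => qpoch_div q (c i * q) (x i)) (fun i k => N (x i) ^+ k).
- by move=> i k; rewrite exprn_ge0// normc_ge0.
- have [n|e e0 eP] := @qpoch_lbound _ _ q_lt1 (c i * q / x i).
    apply: contra (xc i n) => /eqP/subr0_eq E; apply/eqP.
    rewrite -[LHS]mulr1 E exprS; field; exact: x0.
  exists e => // k; rewrite qpoch_divE// Normc.normcM normcX.
  by rewrite ler_wpM2r// exprn_ge0// normc_ge0.
exists (A / (B + 1) * e) => [|k].
  by rewrite mulr_gt0// divr_gt0// ltr_wpDl.
rewrite /lhs_numer /phi_term 3!Normc.normcM Normc.normcV normcX exprMn -prodrXl.
have -> : A / (B + 1) * e * (N t ^+ k * \prod_i N (x i) ^+ k) =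
  A / (B + 1) * N t ^+ k * (e * \prod_i N (x i) ^+ k) by ring.
have B1 : 0 < B + 1 by rewrite ltr_wpDl.
have tk : 0 <= N t ^+ k by rewrite exprn_ge0 ?normc_ge0.
have AB : 0 <= A / (B + 1) by rewrite divr_ge0// ltW.
have xk : 0 <= \prod_i N (x i) ^+ k.
  by rewrite prodr_ge0// => i _; rewrite exprn_ge0 ?normc_ge0.
apply: ler_pM; [exact: mulr_ge0 | exact: mulr_ge0 (ltW e0) _ | | exact: eP].
rewrite ler_wpM2r// ler_pM ?(ltW A0) ?invr_ge0 ?(ltW B1)//.
have b0 : 0 < N (qpochs q b k).
  by apply: normc_gt0; apply/prodf_neq0 => i _; exact: qpoch_neq0.
by rewrite lef_pV2 ?posrE// (le_trans (BP k))// lerDl.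
Qed.

(** If some [x_i = c_i q^{n+1}] or [a_i q^n = 1], the terms vanish from some point on. If some
    [x_i = 0], they decay however large [t] is. Otherwise [lhs_numer_ge] rules out
    [|t| \prod_i |x_i| >= 1]. *)
Lemma lhs_numer_geometric :
  (forall e : R, 0 < e -> exists k, N (lhs_numer k) < e) ->
  exists2 s : R, 0 < s < 1 &
    exists2 C : R, 0 <= C & forall k, N (lhs_numer k) <= C * s ^+ k.
Proof.
move=> u0.
have half01 : 0 < (2^-1 : R) < 1 by apply/andP; split; lra.
have fin M : (forall k, (M <= k)%N -> lhs_numer k = 0) ->
    exists2 s : R, 0 < s < 1 &
    exists2 C : R, 0 <= C & forall k, N (lhs_numer k) <= C * s ^+ k.
  by move=> /finite_support_geometric; exists 2^-1.
have bound (s : 'I_m -> R) : (forall i, 0 < s i) -> (forall i, N (x i) <= s i) ->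
    N t * \prod_i s i < 1 ->
    exists2 s : R, 0 < s < 1 &
    exists2 C : R, 0 <= C & forall k, N (lhs_numer k) <= C * s ^+ k.
  move=> s0 xs; set y := _ * _ => y1; have [C C0 CP] := lhs_numer_le s0 xs.
  have y0 : 0 <= y by rewrite mulr_ge0 ?normc_ge0 ?prodr_ge0// => i _; rewrite ltW.
  (* [y] may be 0; the midpoint of [y] and 1 is a positive ratio. *)
  exists ((1 + y) / 2); first by apply/andP; split; lra.
  exists C => // k; rewrite (le_trans (CP k))// ler_wpM2l//.
  have y2 : y <= (1 + y) / 2 by lra.
  by rewrite lerXn2r ?nnegrE// (le_trans y0 y2).
have [[i [n xE]]|xc] := pselect (exists i n, x i = c i * q ^+ n.+1).
  apply: (fin n.+1) => k nk; rewrite /lhs_numer (bigD1 i)//=.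
  by rewrite (@qpoch_div_eq0 _ _ _ _ _ n) ?mul0r ?mulr0// xE exprS mulrA.
have [[i xi]|x0] := pselect (exists i, x i = 0).
  (* Each zero [x_j] gets the radius [d], and [|t| d < 1]. All radii are at most 1, so a single zero
     suffices. *)
  pose d := (N t + 1)^-1; have t0 := normc_ge0 t.
  have d0 : 0 < d by rewrite invr_gt0; lra.
  have d1 : d <= 1 by rewrite invf_le1; lra.
  apply: (bound (fun j => if x j == 0 then d else N (x j))) => [j|j|].
  - by case: eqVneq => // /normc_gt0.
  - by case: eqVneq => // ->; rewrite Normc.normc0 ltW.
  rewrite (bigD1 i)//= xi eqxx.
  set P := \prod_(_ | _) _.
  have P1 : P <= 1.
    apply: prodr_ile1 => j _; case: eqVneq => _.
      by rewrite (ltW d0) d1.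
    by rewrite normc_ge0 (ltW (x_lt1 j)).
  have P0 : 0 <= P.
    by apply: prodr_ge0 => j _; case: eqVneq => _; rewrite ?normc_ge0 ?(ltW d0).
  have dE : d * (N t + 1) = 1 by rewrite mulVf// gt_eqF//; lra.
  have : N t * (d * P) <= N t * d by rewrite ler_wpM2l// ler_piMr// ltW.
  by lra.
have x0' i : x i != 0 by apply/eqP => xi; apply: x0; exists i.
have [[i [n aE]]|a0] := pselect (exists i n, a i * q ^+ n = 1).
  apply: (fin n.+1) => k nk; rewrite /lhs_numer /phi_term /qpochs (bigD1 i)//=.
  by rewrite (qpoch_eq0 nk aE) !mul0r.
apply: (bound (fun i => N (x i))) => // [i|]; first exact: normc_gt0.
have [||//|e e0 eP] := lhs_numer_ge.
- move=> i n; rewrite subr_eq0 eq_sym; apply/eqP => aE.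
  by apply: a0; exists i, n.
- by move=> i n; apply/eqP => xE; apply: xc; exists i, n.
rewrite ltNge; apply/negP => y1; have [k] := u0 _ e0; apply/negP; rewrite -leNgt.
by rewrite (le_trans _ (eP k))// ler_peMr ?(ltW e0)// exprn_ege1.
Qed.
End LeftTerms.

Lemma series_finite_support (R : realType) (u : nat -> R[i]) M :
  (forall k, (M <= k)%N -> u k = 0) ->
  (series u : nat -> R[i]^o) @ \oo --> (\sum_(k < M) u k : R[i]^o).
Proof.
move=> uM; apply/cvgn_normcP => e e0; exists M => n Mn.
rewrite /series/= (big_cat_nat (leq0n M) Mn)/= big_mkord.
have -> : \sum_(M <= k < n) u k = 0.
  by rewrite big_nat_cond big1// => k /andP[/andP[Mk _] _]; exact: uM.
by rewrite addr0 subrr Normc.normc0.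
Qed.

(** * Convergence and size of the one-index expansion *)

Section Expansion.
Variables (R : realType) (q x c d : R[i]).
Hypothesis q0 : q != 0.
Hypothesis q_lt1 : N q < 1.
Hypothesis d_ok : forall n, d != q ^+ n.+1.
Hypothesis cd_ok : forall n, c * d != q ^- n.+1.
Hypothesis x_lt1 : N x < 1.
Hypothesis xd_ok : N (x * d) < 1 \/ exists M : nat, x = c * q ^+ M.+1.

Lemma Delta_factor_eq0 n k : (n < k)%N -> Delta_factor q n c d k = 0.
Proof.
move=> nk; rewrite /Delta_factor (@qpoch_eq0 _ _ (q ^- n) _ _ nk).
  by rewrite mulr0 !mul0r.
by rewrite mulVf// expf_neq0.
Qed.

Lemma Omega_Delta_kernel n k : (k <= n)%N ->
  Omega q n x c d * Delta_factor q n c d k = kernel q x c d k (n - k).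
Proof.
move=> kn; rewrite -Omega_Delta_factor ?subnKC//.
- exact: one_sub_q_neq0.
- exact: one_sub_cd_neq0.
- by move=> j; apply: one_sub_expr_neq0.
Qed.

Lemma Omega_Delta_cvg k :
  ((fun n => \sum_(j < n) Omega q j x c d * Delta_factor q j c d k)
     : nat -> R[i]^o) @ \oo -->
  (qpoch_div q (c * q) x k / qpoch q (x * d * q) k : R[i]^o).
Proof.
apply/cvgn_normcP => e e0.
have [s s01 /(_ k)[A AP]] := kernel_sum_estimate q0 q_lt1 cd_ok x_lt1 xd_ok.
have [s0 s1] := andP s01; have [n0 n0P] := geometric_small A (ltW s0) s1 e0.
exists (k + n0)%N => n kn; have kn' : (k <= n)%N := leq_trans (leq_addr _ _) kn.
(* The terms with [j < k] vanish, so this is a kernel sum shifted by [k]. *)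
have -> : \sum_(j < n) Omega q j x c d * Delta_factor q j c d k =
    \sum_(j < n - k) kernel q x c d k j.
  rewrite -[in LHS](subnKC kn') big_split_ord/= big1 ?add0r => [|j _].
    apply: eq_bigr => j _; rewrite Omega_Delta_kernel ?leq_addr//.
    by rewrite addKn.
  by rewrite Delta_factor_eq0 ?mulr0.
rewrite -normcN opprB (le_lt_trans (AP _))// n0P//.
by rewrite leq_subRL.
Qed.

Lemma Omega_Delta_le : exists2 s : R, 0 < s < 1 &
  exists2 C : R, 0 <= C & forall k n, (k <= n)%N ->
    N (Omega q n x c d * Delta_factor q n c d k)
      <= C * N (qpoch_div q (c * q) x k) * s ^+ (n - k).
Proof.
have [s s01 [C C0 CP]] := kernel_estimate q0 q_lt1 cd_ok x_lt1 xd_ok.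
exists s => //; exists C => // k n kn; rewrite Omega_Delta_kernel//.
by case: (CP k (n - k)%N).
Qed.
End Expansion.

(** * The transformation for [m] indices *)

Theorem theorem1p3 (R : realType) (q : R[i]) (r m : nat)
    (a b : 'I_r -> R[i]) (t : R[i]) (c d x : 'I_m -> R[i])
    (q_neq0 : q != 0) (q_lt1 : `|q| < 1) (m_gt0 : (0 < m)%N)
    (b_ok : forall (i : 'I_r) (n : nat), b i != q ^- n)
    (c_ok : forall (i : 'I_m) (n : nat), c i != q ^- n.+1)
    (d_ok : forall (i : 'I_m) (n : nat), d i != q ^+ n.+1)
    (cd_ok : forall (i : 'I_m) (n : nat), c i * d i != q ^- n.+1)
    (x_lt1 : forall i : 'I_m, `|x i| < 1)
    (xd_ok : forall i : 'I_m,
       `|x i * d i| < 1 \/ exists N : nat, x i = c i * q ^+ N.+1)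
    (lhs_cvg : converges (lhs_term q a b t c d x)) :
  (forall n : {ffun 'I_m -> nat}, converges (inner_term q a b t c d n)) /\
  has_sum
    (fun n : {ffun 'I_m -> nat} =>
       (\prod_(i < m) Omega q (n i) (x i) (c i) (d i))
       * series_sum (inner_term q a b t c d n))
    (series_sum (lhs_term q a b t c d x)).
Proof.
have norm_lt1 (z : R[i]) : `|z| < 1 -> N z < 1 by rewrite -ltcR.
have q1 := norm_lt1 _ q_lt1.
have x1 i := norm_lt1 _ (x_lt1 i).
have xd1 i : N (x i * d i) < 1 \/ exists M : nat, x i = c i * q ^+ M.+1.
  by case: (xd_ok i) => [/norm_lt1|]; [left | right].
have b1 i n : 1 - b i * q ^+ n != 0.
  rewrite subr_eq0 eq_sym; apply: contra (b_ok i n) => /eqP bE.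
  by rewrite -[X in _ == X]mul1r -bE mulfK// expf_neq0.
(* One index is enough to cut off the inner series after [k = n i0]. *)
pose i0 := Ordinal m_gt0.
pose T i k n := Omega q n (x i) (c i) (d i) * Delta_factor q n (c i) (d i) k.
have T_tri i k n : (n < k)%N -> T i k n = 0.
  by move=> nk; rewrite /T Delta_factor_eq0// mulr0.
have inner0 (n : {ffun 'I_m -> nat}) k : (n i0 < k)%N -> inner_term q a b t c d n k = 0.
  by move=> nk; rewrite /inner_term (bigD1 i0)//= Delta_factor_eq0// mul0r mulr0.
have inner_cvg (n : {ffun 'I_m -> nat}) :=
  @series_finite_support R (inner_term q a b t c d n) (n i0).+1 (inner0 n).
split=> [n|].
  apply/cvg_ex; exists (\sum_(k < (n i0).+1) inner_term q a b t c d n k : R[i]^o).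
  exact: inner_cvg.
rewrite (_ : (fun n => _) = (fun n : {ffun 'I_m -> nat} =>
    \sum_(k < (n i0).+1) phi_term q a b t k * \prod_i T i k (n i))); last first.
  apply/funext => n; rewrite /series_sum.
  rewrite (cvg_lim (@norm_hausdorff _ _) (inner_cvg n)) mulr_sumr.
  apply: eq_bigr => k _; rewrite /inner_term /T [in RHS]big_split/=; ring.
pose f i k := qpoch_div q (c i * q) (x i) k / qpoch q (x i * d i * q) k.
have T_cvg i k : ((fun n => \sum_(j < n) T i k j) : nat -> R[i]^o) @ \oo -->
    (f i k : R[i]^o).
  by apply: Omega_Delta_cvg.
(* The numerator is the left-hand term times a bounded factor, so convergence on the left makes it
   tend to 0. *)
have lhs_numerE k : lhs_numer q a b t c x k =
    lhs_term q a b t c d x k * qpochs q (fun i => x i * d i * q) k.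
  rewrite /lhs_numer /lhs_term -mulrA /qpochs -big_split/=; congr (_ * _).
  apply: eq_bigr => i _; rewrite divfK//; apply: qpoch_neq0 => n.
  exact: (one_sub_xd_neq0 q_neq0 q1 (cd_ok i) (xd1 i)).
have [E E0 EP] := qpochs_le q1 (fun i => x i * d i * q).
have [|s0 s01 [C0 C00 C0P]] := lhs_numer_geometric (a := a) (t := t) (c := c) q1 b1 x1.
  move=> e e0; have E1 : 0 < E + 1 by rewrite ltr_wpDl.
  have /cvgn_normcP/(_ _ (divr_gt0 e0 E1))[k /(_ k (leqnn k))] :=
    cvg_series_cvg_0 lhs_cvg.
  rewrite sub0r normcN ltr_pdivlMr// => kP; exists k.
  rewrite lhs_numerE (le_lt_trans _ kP)// Normc.normcM ler_wpM2l ?normc_ge0//.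
  by rewrite (le_trans (EP k))// lerDl.
have /choice[s sP] : forall i, exists s : R, 0 < s < 1 /\
    exists2 C : R, 0 <= C & forall k n, (k <= n)%N ->
      N (T i k n) <= C * N (qpoch_div q (c i * q) (x i) k) * s ^+ (n - k).
  move=> i; have [s s1 sP] :=
    Omega_Delta_le q_neq0 q1 (d_ok i) (cd_ok i) (x1 i) (xd1 i).
  by exists s.
(* One ratio for the [m] kernels and for [lhs_numer] together. *)
pose y := \big[Num.max/s0]_i s i.
have [s00 s0_lt1] := andP s01.
have y0 : s0 <= y by apply: bigmax_ge_id.
have y1 : y < 1 by apply: bigmax_lt => // i _; have [/andP[]] := sP i.
have sy i : s i <= y by apply: le_bigmax.
have y_gt0 : 0 < y := lt_le_trans s00 y0.
(* By Bernoulli's inequality [y <= u ^+ m.+1]. A single [y ^+ k] thus supplies [u ^+ k] for the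
   outer index and another for each [i], raising the exponent [n i - k] to [n i]. *)
pose u := 1 - (1 - y) / m.+1%:R.
have u01 : 0 <= (1 - y) / m.+1%:R <= 1.
  rewrite divr_ge0 ?subr_ge0 ?(ltW y1)//= ler_pdivrMr ?ltr0n// mul1r.
  by rewrite (@le_trans _ _ 1)// ?gerBl ?(ltW y_gt0)// ler1n.
have yu : y <= u ^+ m.+1.
  rewrite (le_trans _ (bernoulli_1B m.+1 u01))//.
  by rewrite mulrCA divff ?pnatr_eq0// mulr1 opprB addrC subrK.
have u1 : u < 1 by rewrite ltrBlDr ltrDl divr_gt0 ?subr_gt0 ?ltr0n.
have u_ge0 : 0 <= u by rewrite subr_ge0; have [] := andP u01.
have u0 : 0 < u.
  rewrite lt_neqAle u_ge0 andbT; apply: contraTneq yu => <-.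
  by rewrite expr0n/= -ltNge.
have yu1 : y <= u by rewrite (le_trans yu)// exprS ler_piMr// exprn_ile1// ltW.
(* The kernel bounds hold for [k <= n i]; on this subtype [normc_prod_le] handles all factors at
   once. *)
pose dom := {kn : nat * {ffun 'I_m -> nat} | forall i, (kn.1 <= kn.2 i)%N}.
pose G i (kn : dom) := N (qpoch_div q (c i * q) (x i) (sval kn).1)
  * y ^+ ((sval kn).2 i - (sval kn).1).
have [i|C C_ge0 CP] := @normc_prod_le R dom 'I_m
    (fun i kn => T i (sval kn).1 ((sval kn).2 i)) G.
  have [/andP[si0 _] [C C_ge0 CP]] := sP i; exists C => // -[[k n] kn]; rewrite /G/=.
  rewrite (le_trans (CP _ _ (kn i)))// mulrA ler_wpM2l ?mulr_ge0 ?normc_ge0//.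
  by rewrite lerXn2r// nnegrE ltW.
have T_le k (n : {ffun 'I_m -> nat}) :
    N (phi_term q a b t k * \prod_i T i k (n i)) <=
    C * C0 * u ^+ k * \prod_i u ^+ n i.
  have pu : 0 <= \prod_i u ^+ n i by rewrite prodr_ge0// => i _; rewrite exprn_ge0.
  have [kn|/existsNP[i /negP]] := pselect (forall i, (k <= n i)%N); last first.
    rewrite -ltnNge => nk; rewrite (bigD1 i)//= T_tri// mul0r mulr0 Normc.normc0.
    by rewrite !mulr_ge0 ?exprn_ge0.
  have := CP (exist _ (k, n) kn); rewrite [X in _ <= C * X]big_split/= => h.
  have phi0 := normc_ge0 (phi_term q a b t k).
  rewrite Normc.normcM (le_trans (ler_wpM2l phi0 h))//.
  (* The [qpoch_div] factors join [phi_term] to form [lhs_numer], which decays even if [phi_term]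
     alone grows. *)
  rewrite -normc_prod !mulrA [_ * C]mulrC -[C * _ * N _]mulrA -Normc.normcM.
  have yp : 0 <= \prod_i y ^+ (n i - k).
    by rewrite prodr_ge0// => i _; rewrite exprn_ge0// ltW.
  have yn : y ^+ k * \prod_i y ^+ (n i - k) <= u ^+ k * \prod_i u ^+ n i.
    have yk : y ^+ k <= u ^+ k * \prod_(i < m) u ^+ k.
      rewrite prodr_const card_ord -exprM -exprD -mulnS mulnC exprM.
      by rewrite lerXn2r// nnegrE ?exprn_ge0// ltW.
    rewrite (le_trans (ler_wpM2r yp yk))//.
    rewrite -mulrA -big_split ler_wpM2l ?exprn_ge0//.
    apply: ler_prod => i _; rewrite mulr_ge0 ?exprn_ge0 ?(ltW y_gt0)//=.
    rewrite -[in leRHS](subnKC (kn i)) exprD ler_wpM2l ?exprn_ge0//.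
    by rewrite lerXn2r// nnegrE ltW.
  have hk : N (lhs_numer q a b t c x k) <= C0 * y ^+ k.
    by rewrite (le_trans (C0P k))// ler_wpM2l// lerXn2r// nnegrE ltW.
  apply: (@le_trans _ _ (C * (C0 * y ^+ k) * \prod_i y ^+ (n i - k))).
    by rewrite ler_wpM2r// ler_wpM2l.
  rewrite -!mulrA ler_wpM2l// ler_wpM2l//.
have t01 : 0 < u < 1 by rewrite u0 u1.
apply: (has_sum_interchange i0 t01 T_tri T_le T_cvg).
have := lhs_cvg; rewrite /converges /series_sum.
rewrite (_ : series _ = (fun n => \sum_(k < n) phi_term q a b t k * \prod_i f i k))//.
by apply/funext => n; rewrite /series/= big_mkord.
Qed.
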